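(* Let $P\subset\mathbb{R}^d$ be a finite spherical set with circumradius $\rho$, and suppose that $P$ admits a solvable group of isometries of $\mathbb{R}^d$ that preserves $P$ and acts transitively on $P$. Then $P$ is nearcircumsphere-Ramsey; that is, for every $r\in\mathbb{N}$ and every $\varepsilon>0$ there is a dimension $n$ such that every $r$-coloring of the sphere $\mathbb{S}^n_{\rho+\varepsilon}$ contains a monochromatic congruent copy of $P$.
   Context: A finite set $P\subset\mathbb{R}^d$ is spherical if some sphere contains it. In that case there are a unique point $o\in\operatorname{aff}P$ (the circumcenter) and a unique $\rho\ge 0$ (the circumradius) such that $\|p-o\|=\rho$ for all $p\in P$. For $R>0$ write $\mathbb{S}^n_R=\{x\in\mathbb{R}^{n+1}:\|x\|=R\}$. An $r$-coloring is a map to an $r$-element set of colors. A congruent copy of $P$ is an isometric image of $P$. *)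

(* Defs.v *)
From HB Require Import structures.
From mathcomp Require Import all_boot all_order all_algebra.
From mathcomp Require Import all_classical all_reals.

Set Implicit Arguments.
Unset Strict Implicit.
Unset Printing Implicit Defensive.

Import Order.TTheory GRing.Theory Num.Theory.

Local Open Scope classical_set_scope.
Local Open Scope ring_scope.

(* The canonical norm on row vectors in MathComp-Analysis is the sup norm,
   hence an explicit Euclidean norm. *)
Definition enorm (R : realType) (d : nat) (u : 'rV[R]_d) : R :=
  Num.sqrt (\sum_(i < d) u 0 i ^+ 2).

Definition sphere (R : realType) (n : nat) (rad : R) : set 'rV[R]_n.+1 :=
  [set x | enorm x = rad].

Arguments sphere {R} n rad.

(* Radius zero is allowed, so that one-point sets are spherical also when
   d = 0. *)
Definition spherical (R : realType) (d : nat) (P : set 'rV[R]_d) : Prop :=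
  exists c : 'rV[R]_d, exists2 s : R, 0 <= s &
    forall p, P p -> enorm (p - c) = s.

Definition affine_hull (R : realType) (d : nat) (P : set 'rV[R]_d) :
    set 'rV[R]_d :=
  [set x | exists (k : nat) (p : 'I_k -> 'rV[R]_d) (w : 'I_k -> R),
     [/\ forall i, P (p i), \sum_(i < k) w i = 1
       & x = \sum_(i < k) w i *: p i]].

Definition is_circumcenter (R : realType) (d : nat) (P : set 'rV[R]_d)
    (o : 'rV[R]_d) (rho : R) : Prop :=
  affine_hull P o /\ forall p, P p -> enorm (p - o) = rho.

(* The empty set has no circumradius, its affine hull being empty. *)
Definition is_circumradius (R : realType) (d : nat) (P : set 'rV[R]_d)
    (rho : R) : Prop :=
  0 <= rho /\ exists o, is_circumcenter P o rho.

Definition isometric_on (R : realType) (d m : nat) (A : set 'rV[R]_d)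
    (f : 'rV[R]_d -> 'rV[R]_m) : Prop :=
  forall x y, A x -> A y -> enorm (f x - f y) = enorm (x - y).

Section IsometryGroup.
Variables (R : realType) (d : nat).

Record Isom := MkIsom {
  isom_fun :> 'rV[R]_d -> 'rV[R]_d;
  isomP : `[< isometric_on setT isom_fun /\ bijective isom_fun >]
}.

HB.instance Definition _ := [isSub for isom_fun].
HB.instance Definition _ := [Choice of Isom by <:].

Lemma isom_one_subproof :
  `[< isometric_on setT (@id 'rV[R]_d) /\ bijective (@id 'rV[R]_d) >].
Proof. by apply/asboolP; split=> //; exists id. Qed.

Definition isom_one := MkIsom isom_one_subproof.

Lemma isom_mul_subproof (f g : Isom) :
  `[< isometric_on setT (f \o g) /\ bijective (f \o g) >].
Proof.
apply/asboolP; case: f g => [f /asboolP[fi fb]] [g /asboolP[gi gb]] /=.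
by split; [move=> x y _ _; rewrite /= fi// gi | exact: bij_comp].
Qed.

Definition isom_mul (f g : Isom) := MkIsom (isom_mul_subproof f g).

Lemma isom_inv_exists (f : Isom) :
  exists g : Isom, cancel f g /\ cancel g f.
Proof.
case: f => [f /asboolP[fi [g fK gK]]] /=.
suff gP : `[< isometric_on setT g /\ bijective g >] by exists (MkIsom gP).
apply/asboolP; split; last by exists f.
by move=> x y _ _; rewrite -[in RHS](gK x) -[in RHS](gK y) fi.
Qed.

Definition isom_inv (f : Isom) : Isom :=
  projT1 (cid (isom_inv_exists f)).

Lemma isom_mulA : associative isom_mul.
Proof. by move=> f g h; apply: val_inj. Qed.

Lemma isom_mul1 : left_id isom_one isom_mul.
Proof. by move=> f; apply: val_inj. Qed.

Lemma isom_mulr1 : right_id isom_one isom_mul.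
Proof. by move=> f; apply: val_inj. Qed.

Lemma isom_mulV : left_inverse isom_one isom_inv isom_mul.
Proof.
move=> f; apply: val_inj; rewrite /= /isom_inv.
by case: cid => g [fK gK] /=; apply/funext => x /=; rewrite fK.
Qed.

Lemma isom_mulrV : right_inverse isom_one isom_inv isom_mul.
Proof.
move=> f; apply: val_inj; rewrite /= /isom_inv.
by case: cid => g [fK gK] /=; apply/funext => x /=; rewrite gK.
Qed.

HB.instance Definition _ := isGroup.Build Isom
  isom_mulA isom_mul1 isom_mulr1 isom_mulV isom_mulrV.

End IsometryGroup.

(* MathComp's solvability theory is restricted to finite groups, whereas a
   group of isometries may be infinite; the derived series is therefore set up
   for subgroups, given as sets, of an arbitrary group. *)
Section Solvable.
Variable gT : groupType.

Definition is_subgroup (G : set gT) : Prop := group_closed (mem G).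

Definition derived_subgroup (G : set gT) : set gT :=
  smallest is_subgroup [set [~ x, y]%g | x in G & y in G].

Definition derived_series (G : set gT) (n : nat) : set gT :=
  iter n derived_subgroup G.

Definition is_solvable (G : set gT) : Prop :=
  exists n, derived_series G n = [set 1%g].

End Solvable.

Definition preserves (R : realType) (d : nat) (G : set (Isom R d))
    (P : set 'rV[R]_d) : Prop :=
  forall g, G g -> g @` P = P.

Definition acts_transitively (R : realType) (d : nat) (G : set (Isom R d))
    (P : set 'rV[R]_d) : Prop :=
  forall x y, P x -> P y -> exists2 g, G g & g x = y.

Definition congruent_copy (R : realType) (d m : nat) (P : set 'rV[R]_d)
    (Q : set 'rV[R]_m) : Prop :=
  exists2 f : 'rV[R]_d -> 'rV[R]_m, isometric_on P f & Q = f @` P.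

(* The argument rho is meant to be the circumradius of P. *)
Definition nearcircumsphere_ramsey (R : realType) (d : nat)
    (P : set 'rV[R]_d) (rho : R) : Prop :=
  forall (r : nat) (eps : R), 0 < eps ->
  exists n : nat, forall chi : sphere n (rho + eps) -> 'I_r,
  exists Q : set 'rV[R]_n.+1,
    [/\ congruent_copy P Q, Q `<=` sphere n (rho + eps)
      & exists c : 'I_r,
          forall x : sphere n (rho + eps), Q (val x) -> chi x = c].

(* Main.v *)
Require Import Defs.
From mathcomp Require Import all_boot all_order all_algebra.
From mathcomp Require Import all_fingroup all_solvable.
From mathcomp Require Import all_classical all_reals.
From mathcomp Require Import zify ring lra.

(** The points of P are used as an alphabet T, and a word, that is a function
from a finite set Om of cells to T, is turned into the vector whose blocks are
the letters minus the circumcenter, scaled by a common factor and completed by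
one constant coordinate. All words over Om get the same norm, so a coloring of
the sphere is a coloring of words. Suppose that in a word depending on a letter
y exactly k cells carry a symmetry of P applied to y and the other cells carry
constants. With the scaling 1 / sqrt k the vectors of this family form an exact
congruent copy of P, on a sphere of radius rho * sqrt (#|Om| / k). It is
therefore enough to find, for every coloring of words, a monochromatic family of
this form, where k and #|Om| do not depend on the coloring and #|Om| / k is as
close to 1 as desired.

More generally a scheme over an index set I plugs the letters of a word over I,
moved by symmetries, into the cells of a longer word. A relation E on letters is
achievable if every coloring of words over a suitable Om has a scheme after
which the color of a word over I does not change when letters are replaced by
E-related letters, with the size constraints above. Equality is achievable, and
schemes compose, so E can be enlarged in steps. When E is the orbit relation of
a transitive group, the case of a one-element I gives the theorem.

The step (merge_step) takes an equivalence E invariant under a symmetry tau, and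
a letter z. Given that z, tau z, ..., tau^(l-1) z may already be exchanged
freely, it makes tau^l z exchangeable with them, where l is less than the order
q of tau. The cells are the sequences w on a large set of positions, and the
word written along a window of positions is read off the pattern of rare marks
(w x = 0) in the window: after each mark, complete cycles
z, tau z, ..., tau^(q-1) z are run through, until the next mark comes too close,
and the letter is z in the meantime. Since the first l letters of a cycle are
interchangeable with z, a cycle can be preceded and followed by a pause of any
length, hence the words read in l + 1 successive windows look, cell by cell,
either like y, tau y, ..., tau^l y for a single letter y, or constant
(lead_phase, lead_phase_merge). Ramsey's theorem makes the color independent of
the choice of the windows, so passing to the next window does not change the
color, although it applies tau to almost all letters. The proportion of constant
cells does not depend on the windows, and is small because the marks can be made
rare while a long window still contains one (lead_density). Placing windows of
one homogeneous set next to each other treats all indices of I at once.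

Running l up to q, and z through all letters, achieves the join of E with the
orbits of tau (achievable_join). If E contains the orbit relation of H' = [H, H]
and is invariant under H, then so is its join with the orbits of any tau in H,
because tau commutes with H up to H'; so one can pass from the orbits of H' to
the orbits of H (achievable_der1). Going up the derived series of a solvable
group, from equality to its orbit relation, proves achievable_solvable. *)

Set Implicit Arguments.
Unset Strict Implicit.
Unset Printing Implicit Defensive.

Import Order.TTheory GRing.Theory Num.Theory.

(** * Ramsey's theorem for lists *)

(** The induction step of Ramsey's theorem, from K-element to K.+1-element
sublists. The targets [h c] are allowed to depend on the color, so that the
proof is an induction on their sum. *)
Lemma ramsey_step (C : finType) (X : eqType) (K : nat) :
  (forall h, exists M, forall (l : seq X) (f : seq X -> C),
     M <= size l -> exists s, [/\ subseq s l, size s = h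
       & exists c, forall t, subseq t s -> size t = K -> f t = c]) ->
  forall N, exists M, forall (h : C -> nat) (l : seq X) (f : seq X -> C),
    \sum_c h c <= N -> M <= size l ->
    exists s c, [/\ subseq s l, size s = h c
      & forall t, subseq t s -> size t = K.+1 -> f t = c].
Proof.
move=> IHK; elim=> [|N [M IHN]].
  exists 1 => h [//|x l] f hN _.
  exists [::], (f [::]); split=> //.
    apply/esym/eqP; rewrite -leqn0 (leq_trans _ hN)//.
    by rewrite (bigD1 (f [::]))//= leq_addr.
  by move=> t; rewrite subseq0 => /eqP->.
have [M' HM'] := IHK M.
(* The head x of l colors the K-element sublists of the rest; inside a
   homogeneous list of color c the target of c decreases by one. *)
exists M'.+1 => h [//|x l] f hN szl.
have [l' [l'l szl' [c Hc]]] := HM' l (fun t => f (x :: t)) szl.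
have [hc0|hc0] := posnP (h c).
  exists [::], c; split=> //.
  by move=> t; rewrite subseq0 => /eqP->.
pose h' d := h d - (d == c).
have h'N : \sum_d h' d <= N.
  rewrite (bigD1 c)//= -ltnS (leq_trans _ hN)// [X in _ <= X](bigD1 c)//=.
  rewrite /h' eqxx -addSn leq_add//; first by rewrite subn1 prednK.
  by apply: leq_sum => d _; rewrite leq_subr.
have [s [d [sl' szs Hs]]] := IHN h' l' f h'N (eq_leq (esym szl')).
have sl : subseq s (x :: l).
  exact: (subseq_trans (subseq_trans sl' l'l) (subseq_cons _ _)).
have [dc|dc] := eqVneq d c; last first.
  by exists s, d; split=> //; rewrite szs /h' (negbTE dc) subn0.
exists (x :: s), c; split.
- by rewrite /= eqxx (subseq_trans sl').
- by rewrite /= szs /h' dc eqxx subn1 prednK.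
case=> [//|y t] /=; case: eqP => [->|_] sts [szt].
  by apply: Hc szt; apply: subseq_trans sl'.
by rewrite -dc; apply: Hs => //=; rewrite szt.
Qed.

Lemma ramsey (C : finType) (X : eqType) (K h : nat) :
  exists M, forall (l : seq X) (f : seq X -> C), M <= size l ->
    exists s, [/\ subseq s l, size s = h
      & exists c, forall t, subseq t s -> size t = K -> f t = c].
Proof.
elim: K h => [|K IHK] h.
  exists h => l f szl; exists (take h l); split.
  - exact: take_subseq.
  - by rewrite size_takel.
  - by exists (f [::]) => t _ /size0nil->.
have [M HM] := ramsey_step IHK (\sum_(c : C) h).
exists M => l f szl.
have [s [c [sl szs Hs]]] := HM (fun=> h) l f (leqnn _) szl.
by exists s; split=> //; exists c.
Qed.

Lemma subseq_map_nth (s idx : seq nat) :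
  sorted ltn idx -> all (gtn (size s)) idx ->
  subseq [seq nth 0 s i | i <- idx] s.
Proof.
move=> idx_sorted /allP idx_lt; rewrite -[X in subseq _ X](mkseq_nth 0).
apply: map_subseq.
rewrite (_ : idx = [seq i <- iota 0 (size s) | i \in idx]) ?filter_subseq//.
apply: (irr_sorted_eq ltn_trans ltnn idx_sorted).
  by rewrite sorted_filter ?iota_ltn_sorted//; apply: ltn_trans.
move=> i; rewrite mem_filter mem_iota add0n /=.
by case: (boolP (i \in idx)) => //= /idx_lt.
Qed.

(** Cut s into n blocks of length a + b; the windows of length a that start at
place [j i <= b] of the i-th block form a sublist of s. *)
Lemma subseq_blocks (s : seq nat) (n a b : nat) (j : nat -> nat) :
  size s = n * (a + b) -> (forall i, j i <= b) ->
  subseq (mkseq (fun y =>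
    nth 0 s (y %/ a * (a + b) + j (y %/ a) + y %% a)) (n * a)) s.
Proof.
move=> szs jb.
have [->|a0] := posnP a; first by rewrite muln0 sub0seq.
rewrite /mkseq (map_comp (nth 0 s)).
apply: subseq_map_nth.
  apply: (@homo_sorted _ _ _ ltn ltn); last exact: iota_ltn_sorted.
  move=> x y xy.
  have := jb (x %/ a); have := ltn_pmod x a0; have := leq_div2r a (ltnW xy).
  rewrite leq_eqVlt => /predU1P[e|lt_xy].
    move=> _ _; rewrite /= e ltn_add2l; move: xy => /=.
    by rewrite {1}(divn_eq x a) {1}(divn_eq y a) e ltn_add2l.
  move=> xm jx /=.
  have := leq_mul lt_xy (leqnn (a + b)); rewrite mulSn; lia.
apply/allP => i /mapP[y]; rewrite mem_iota add0n => /andP[_ ylt] ->.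
rewrite /= szs.
have yn : y %/ a < n by rewrite ltn_divLR.
have := jb (y %/ a); have := ltn_pmod y a0.
have := leq_mul yn (leqnn (a + b)); rewrite mulSn; lia.
Qed.

(** * Cycles between marks *)

(** With [mk x] meaning that there is a mark at x: the interval [s, s + q) is a
cycle if s is at distance k * q, for some k < D, from the last mark at or before
s, and there is no mark in the interval after s. *)
Definition cycle_start (q D : nat) (mk : nat -> bool) (s : nat) : bool :=
  [exists k : 'I_D, [&& k * q <= s, mk (s - k * q)
    & [forall x : 'I_(k * q + q), (0 < x) ==> ~~ mk (s - k * q + x)]]].

Lemma cycle_startP (q D : nat) (mk : nat -> bool) (s : nat) :
  reflect (exists k, [/\ k < D, k * q <= s, mk (s - k * q)
             & forall x, s - k * q < x < s + q -> ~~ mk x])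
          (cycle_start q D mk s).
Proof.
apply: (iffP existsP) =>
  [[k /and3P[ks mks /forallP nomk]]|[k [kD ks mks nomk]]].
  exists k; split=> // x /andP[x1 x2].
  have xlt : x - (s - k * q) < k * q + q by lia.
  have := nomk (Ordinal xlt); rewrite /= subn_gt0 x1 /=.
  by rewrite subnKC// ltnW.
exists (Ordinal kD); rewrite ks mks /=; apply/forallP => x; apply/implyP => x0.
by apply: nomk; have := ltn_ord x; rewrite /=; lia.
Qed.

(** Cycles are disjoint: two overlapping ones would start from the same mark,
and then differ by a multiple of q. *)
Lemma cycle_start_sep (q D : nat) (mk : nat -> bool) (s s' : nat) :
  cycle_start q D mk s -> cycle_start q D mk s' -> s < s' -> s + q <= s'.
Proof.
move=> /cycle_startP[k [_ ks mks nomk]].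
move=> /cycle_startP[k' [_ ks' mks' nomk']] ss'.
rewrite leqNgt; apply/negP => s's.
have h1 : ~~ (s - k * q < s' - k' * q).
  by apply/negP => h; have := nomk (s' - k' * q); rewrite h mks' /=; lia.
have h2 : ~~ (s' - k' * q < s - k * q).
  by apply/negP => h; have := nomk' (s - k * q); rewrite h mks /=; lia.
have [kk'|kk'] := ltnP k k'.
  by have := leq_mul kk' (leqnn q); rewrite mulSn; lia.
by have := leq_mul kk' (leqnn q); lia.
Qed.

Lemma cycle_start_shift (q D j : nat) (mk : nat -> bool) (s : nat) :
  D * q <= s + q ->
  cycle_start q D (fun x => mk (j + x)) s = cycle_start q D mk (s + j).
Proof.
move=> Ds; apply: eq_existsb => k.
have kq : k * q <= s.
  by have := leq_mul (ltn_ord k) (leqnn q); rewrite mulSn; lia.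
rewrite kq (leq_trans kq (leq_addr _ _)) /=.
have -> : j + (s - k * q) = s + j - k * q by lia.
congr (_ && _); apply: eq_forallb => x; congr (_ ==> ~~ mk _); lia.
Qed.

Lemma cycle_start_local (q D : nat) (mk mk' : nat -> bool) (s : nat) :
  0 < q -> (forall x, x < s + q -> mk x = mk' x) ->
  cycle_start q D mk s = cycle_start q D mk' s.
Proof.
move=> q0 mkE; apply: eq_existsb => k.
case: (leqP (k * q) s) => //= ks; rewrite mkE; last lia.
congr (_ && _); apply: eq_forallb => x; congr (_ ==> ~~ _); apply: mkE.
have := ltn_ord x; lia.
Qed.

(** The place of the position D * q in its cycle, when this place is at least
l; [None] means that the position is in a pause or among the first l places. *)
Definition phase (l q D : nat) (mk : nat -> bool) : option nat :=
  omap val [pick c : 'I_q | (l <= c) && cycle_start q D mk (D * q - c)].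

(** The place of the position D * q with respect to a cycle that contains, at a
place at least l, one of the positions D * q, ..., D * q + l. *)
Definition lead (l q D : nat) (mk : nat -> bool) : option nat :=
  omap (fun jc : 'I_l.+1 * 'I_q => jc.2 - jc.1)
    [pick jc : 'I_l.+1 * 'I_q | (l <= jc.2) &&
       cycle_start q D mk (D * q + jc.1 - jc.2)].

(** The phases of the l + 1 windows starting at 0, ..., l either are all
undefined or follow one counter running from [e], except that they are undefined
where the counter is, modulo q, below l. *)
Lemma lead_phase (l q D j : nat) (mk : nat -> bool) :
  0 < D -> j <= l -> l < q ->
  match lead l q D mk with
  | None => phase l q D (fun x => mk (j + x)) = None
  | Some e =>
      match phase l q D (fun x => mk (j + x)) with
      | Some c => c = e + j
      | None => (e + j < l) || (q <= e + j < q + l)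
      end
  end.
Proof.
move=> D0 jl lq; rewrite /lead /phase.
have Dq : q <= D * q by rewrite leq_pmull.
have shiftE (c : 'I_q) : cycle_start q D (fun x => mk (j + x)) (D * q - c)
    = cycle_start q D mk (D * q + j - c).
  have := ltn_ord c => cq.
  by rewrite cycle_start_shift; [congr cycle_start; lia | lia].
case: pickP => [[j1 c1] /andP[/= lc1 st1]|nolead] /=; last first.
  case: pickP => //= c /andP[lc]; rewrite shiftE => st.
  have jl' : j < l.+1 by [].
  by have := nolead (Ordinal jl', c); rewrite /= lc st.
have := ltn_ord j1; have := ltn_ord c1 => c1q j1l.
case: pickP => [c /andP[lc]|nophase] /=.
  rewrite shiftE => st; have := ltn_ord c => cq.
  have [lt|lt|] := ltngtP (D * q + j1 - c1) (D * q + j - c); last lia.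
    by have := cycle_start_sep st1 st lt; lia.
  by have := cycle_start_sep st st1 lt; lia.
case: (ltnP (c1 - j1 + j) l) => //= le.
have [//|eq] := leqP q (c1 - j1 + j); first lia.
have := nophase (Ordinal eq); rewrite shiftE /= le /=.
by rewrite (_ : D * q + j - _ = D * q + j1 - c1) ?st1//; lia.
Qed.

Lemma lead_local (l q D : nat) (mk mk' : nat -> bool) :
  l < q -> (forall x, x < (D + 2) * q -> mk x = mk' x) ->
  lead l q D mk = lead l q D mk'.
Proof.
move=> lq mkE; rewrite /lead; congr (omap _ _); apply: eq_pick => -[j c] /=.
case: (leqP l c) => //= lc; apply: cycle_start_local => [|x xlt]; first lia.
by apply: mkE; have := ltn_ord j; have := ltn_ord c; rewrite mulnDl; lia.
Qed.

(** If a window has a mark in [q, D * q] but none after D * q, the cycles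
following the last mark run past D * q + l. *)
Lemma lead_some (l q D : nat) (mk : nat -> bool) :
  l < q -> (exists2 x, q <= x <= D * q & mk x) ->
  (forall x, D * q < x < D * q + 2 * q -> ~~ mk x) ->
  lead l q D mk != None.
Proof.
move=> lq [x0 x0b mkx0] nomk.
have ex : exists x, (q <= x <= D * q) && mk x by exists x0; rewrite x0b.
have ub x : (q <= x <= D * q) && mk x -> x <= D * q by case/andP=> /andP[].
case: (ex_maxnP ex ub) => m /andP[/andP[qm mD] mkm] mmax.
(* m is the last mark up to D * q, and the position D * q + j is the first one
   from D * q on whose place r + j in its cycle is at least l. *)
pose r := (D * q - m) %% q.
have q0 : 0 < q by apply: leq_ltn_trans lq.
pose j := l - r.
have rq : r < q by rewrite ltn_pmod.
have jl : j < l.+1 by rewrite ltnS leq_subr.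
have cq : r + j < q by rewrite /j; lia.
have lc : l <= r + j by rewrite /j; lia.
rewrite /lead; case: pickP => //= /(_ (Ordinal jl, Ordinal cq)) /=.
rewrite lc /= => /negbT/negP[]; apply/cycle_startP.
have dE := divn_eq (D * q - m) q; rewrite -/r in dE.
set k := (D * q - m) %/ q in dE.
exists k; split.
- by rewrite -(ltn_pmul2r q0); lia.
- lia.
- by rewrite (_ : _ - _ = m) //; lia.
- move=> x /andP[x1 x2].
  have [xD|xD] := leqP x (D * q); last by apply: nomk; lia.
  apply/negP => mkx.
  have := mmax x; rewrite mkx xD; lia.
Qed.

(** * The density of the marked windows *)

(** A property of the restriction of w to the image of p has a probability that
does not depend on the injection p. *)
Lemma card_pullback (X Y V : finType) (p : X -> Y) (Q : pred {ffun X -> V}) :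
  injective p ->
  #|[pred w : {ffun Y -> V} | Q [ffun x => w (p x)]]|
    = #|Q| * #|V| ^ (#|Y| - #|X|).
Proof.
move=> pinj; rewrite -sum1_card.
rewrite (partition_big (fun w : {ffun Y -> V} => [ffun x => w (p x)]) Q) //=.
rewrite -sum_nat_const; apply: eq_bigr => eta Qeta.
pose F (y : Y) : pred V :=
  if [pick x | p x == y] is Some x then pred1 (eta x) else predT.
rewrite sum1_card (_ : #|_| = #|family F|); last first.
  apply: eq_card => w; apply/andP/familyP => [[_ /eqP weta] y|wF].
    rewrite /F; case: pickP => // x /eqP <-.
    by rewrite -weta inE ffunE.
  suff weta : [ffun x => w (p x)] = eta by rewrite inE weta.
  apply/ffunP => x; rewrite ffunE; have := wF (p x); rewrite /F.
  by case: pickP => [x' /eqP/pinj-> /eqP//|/(_ x)]; rewrite eqxx.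
rewrite card_family foldrE big_map big_enum /=.
rewrite (bigID (mem (codom p))) /= big1 ?mul1n; last first.
  move=> y /codomP[x ->]; rewrite /F.
  by case: pickP => [x' _|/(_ x)]; rewrite ?eqxx// card1.
rewrite (eq_bigr (fun=> #|V|)); last first.
  move=> y ynp; rewrite /F; case: pickP => [x /eqP xy|_]; last exact: eq_card.
  by rewrite -xy codom_f in ynp.
rewrite prod_nat_const; congr (_ ^ _).
rewrite -(card_codom pinj) -[X in X - _](cardC (mem (codom p))) addKn.
exact: eq_card.
Qed.

Lemma card_ffun_in (X V : finType) (J : pred X) (A : pred V) :
  #|[pred w : {ffun X -> V} | [forall x in J, A (w x)]]|
    = #|A| ^ #|J| * #|V| ^ (#|X| - #|J|).
Proof.
pose F (x : X) : pred V := if x \in J then A else predT.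
transitivity #|family F|.
  apply: eq_card => w; apply/forall_inP/familyP => wF x.
    by rewrite /F; case: ifP => // /wF.
  by move=> xJ; have := wF x; rewrite /F xJ.
rewrite card_family foldrE big_map big_enum /= (bigID (mem J)) /=.
rewrite (eq_bigr (fun=> #|A|)); last by move=> x xJ; rewrite /F xJ.
rewrite [X in _ * X](eq_bigr (fun=> #|V|)); last first.
  by move=> x /negbTE xJ; rewrite /F xJ.
rewrite !prod_nat_const; congr (_ ^ _ * _ ^ _).
by rewrite -[X in X - _](cardC J) addKn.
Qed.

(** The marks of a sequence w are its zeros; there is none from m on. *)
Definition marks (m b : nat) (w : {ffun 'I_m -> 'I_b.+1}) (x : nat) : bool :=
  oapp (fun i => w i == ord0) false (insub x).

Lemma marksE (m b : nat) (w : {ffun 'I_m -> 'I_b.+1}) (i : 'I_m) :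
  marks w i = (w i == ord0).
Proof. by rewrite /marks valK. Qed.

(** That is, (b / (b + 1)) ^ a <= b / a. *)
Lemma pow_bernoulli (a b : nat) : a * b ^ a <= b * b.+1 ^ a.
Proof.
elim: a => [|a IHa]; first by rewrite mul0n.
have h : b ^ a <= b.+1 ^ a by case: a {IHa} => // a; rewrite leq_exp2r.
rewrite !expnS; nia.
Qed.

(** For suitable D and b, the windows on which [lead] is defined have proportion
at least g / (g + 1). *)
Lemma lead_density (l q g : nat) : l < q ->
  exists D b, [/\ 0 < D,
    0 < #|[pred w : {ffun 'I_((D + 2) * q) -> 'I_b.+1} |
            lead l q D (marks w) != None]| &
    #|{ffun 'I_((D + 2) * q) -> 'I_b.+1}| * g <=
    g.+1 * #|[pred w : {ffun 'I_((D + 2) * q) -> 'I_b.+1} |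
               lead l q D (marks w) != None]|].
Proof.
move=> lq; have q0 : 0 < q by apply: leq_ltn_trans lq.
(* Marks have probability 1 / (b + 1): small enough for the 2 * q positions
   after D * q to be most likely free of marks (bad2). Then D is taken large
   enough for a mark to be likely in [q, D * q] (bad1). *)
pose b := (8 * q * g.+1).-1.
have bE : b.+1 = 8 * q * g.+1 by rewrite prednK// !muln_gt0 q0.
pose D := (2 * g.+1 * b).+1.
exists D, b; pose m := (D + 2) * q; pose X := #|{ffun 'I_m -> 'I_b.+1}|.
pose good := #|[pred w : {ffun 'I_m -> 'I_b.+1} |
  lead l q D (marks w) != None]|.
rewrite -/m -/X -/good.
have XE : X = b.+1 ^ m by rewrite /X card_ffun !card_ord.
pose J1 := [pred x : 'I_m | q <= x <= D * q].
pose J2 := [pred x : 'I_m | D * q < x].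
pose bad1 := [pred w : {ffun 'I_m -> 'I_b.+1} | [forall x in J1, w x != ord0]].
pose bad2 x := [pred w : {ffun 'I_m -> 'I_b.+1} | w x == ord0].
have badsub : X <= good + #|bad1| + \sum_(x in J2) #|bad2 x|.
  rewrite (eq_bigr (fun x => \sum_w (bad2 x w : nat))); last first.
    by move=> x _; rewrite -sum1_card big_mkcond.
  rewrite /X /good -!sum1_card [X in X <= _]big_mkcond.
  rewrite [X in _ <= X + _ + _]big_mkcond [X in _ <= _ + X + _]big_mkcond.
  rewrite exchange_big -!big_split /=; apply: leq_sum => w _.
  rewrite !inE; case: (boolP (lead _ _ _ _ == None)) => //= leadw.
  case: (boolP [forall x in J1, w x != ord0]) => //= /forall_inPn[x0 x0J].
  rewrite negbK => wx0.
  have [x /andP[/= xJ wx]|no] := pickP [pred x in J2 | w x == ord0].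
    by rewrite (bigD1 x)//= wx.
  suff /negP[] : lead l q D (marks w) != None by [].
  apply: lead_some => // [|x /andP[xD xlt]].
    by exists x0; rewrite ?marksE.
  have xm : x < m by rewrite /m mulnDl.
  by have := no (Ordinal xm); rewrite /= inE /= xD /= -marksE => /negbT.
have J1m : #|J1| <= m by rewrite -[X in _ <= X]card_ord max_card.
have bad1E : #|bad1| = b ^ #|J1| * b.+1 ^ (m - #|J1|).
  rewrite /bad1 (card_ffun_in J1 (predC1 ord0)) !card_ord; congr (_ ^ _ * _).
  by have := cardC (pred1 (@ord0 b)); rewrite card1 card_ord add1n => -[].
have bad2E x : #|bad2 x| = b.+1 ^ m.-1.
  have := card_ffun_in (pred1 x) (pred1 (@ord0 b)).
  rewrite !card1 !card_ord exp1n mul1n subn1 => <-; apply: eq_card => w.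
  rewrite !inE; apply/idP/forall_inP => [wx y /eqP->//|]; apply; exact: eqxx.
have J1g : 2 * g.+1 * b <= #|J1|.
  have f x : (x < (D.-1) * q) -> q + x < m by rewrite /m mulnDl; lia.
  have : #|'I_(D.-1 * q)| <= #|J1|.
    pose h (x : 'I_(D.-1 * q)) := Ordinal (f _ (ltn_ord x)).
    have hinj : injective h by move=> x y [] /addnI /val_inj.
    rewrite -(card_codom hinj).
    apply/subset_leq_card/fintype.subsetP => _ /codomP[x ->].
    rewrite !inE /=; have := ltn_ord x; rewrite /D /=; lia.
  by rewrite card_ord; apply: leq_trans; rewrite /D /= leq_pmulr.
have J2g : #|J2| <= 2 * q.
  have f (x : 'I_m) : x - D * q < 2 * q.
    have mE : m = D * q + 2 * q by rewrite /m mulnDl.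
    by have := ltn_ord x; lia.
  pose h (x : 'I_m) := Ordinal (f x).
  rewrite -[2 * q]card_ord -(card_in_imset (f := h) (D := J2)) ?max_card//.
  move=> x y; rewrite !inE => xD yD [] e; apply: val_inj => /=; lia.
have b0 : 0 < b.
  have : 0 < q * g.+1 by rewrite muln_gt0 q0.
  by move: bE; rewrite -mulnA; lia.
have b1 : 2 * g.+1 * #|bad1| <= X.
  have : #|J1| * #|bad1| <= b * X.
    rewrite XE bad1E mulnA.
    apply: (leq_trans (leq_mul (pow_bernoulli _ _) (leqnn _))).
    by rewrite -mulnA -expnD subnKC.
  move=> h; rewrite -(leq_pmul2l b0) mulnA (mulnC b).
  exact: leq_trans (leq_mul J1g (leqnn _)) h.
have b2 : 4 * g.+1 * (\sum_(x in J2) #|bad2 x|) <= X.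
  rewrite (eq_bigr (fun=> b.+1 ^ m.-1)); last by move=> x _; rewrite bad2E.
  rewrite sum_nat_const XE.
  have m0 : 0 < m by rewrite muln_gt0 q0 addn2.
  have h : 4 * g.+1 * #|J2| <= b.+1.
    by rewrite bE; have := leq_mul (leqnn g.+1) J2g; lia.
  by rewrite -[X in _ <= _ ^ X](prednK m0) expnS mulnA leq_mul.
have X0 : 0 < X by rewrite XE expn_gt0.
have := leq_mul (leqnn g.+1) badsub; rewrite !mulnDr.
rewrite -mulnA in b1; rewrite -mulnA in b2.
move: b1 b2; rewrite (mulnC X).
set u := g.+1 * #|bad1|; set v := g.+1 * \sum_(x in J2) _; set w := g.+1 * good.
rewrite mulSn => b1 b2 b3; split=> //; last lia.
rewrite lt0n; apply/eqP => good0; move: b3; rewrite /w good0 muln0; lia.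
Qed.

(** * Schemes and achievable relations *)

(** The ratio bounds 1 + 1 / (3 * g) of two schemes give 1 + 1 / g for their
composite. *)
Lemma ratio_comp a j i k k' g : a * (3 * g) <= (3 * g).+1 * (j * k) ->
  j * (3 * g) <= (3 * g).+1 * (i * k') -> a * g <= g.+1 * (i * (k' * k)).
Proof.
have [->|g0] := posnP g; first by rewrite !muln0.
move=> h1 h2; rewrite -(@leq_pmul2r (9 * g)); last by rewrite muln_gt0.
have sq : (3 * g).+1 * (3 * g).+1 <= g.+1 * (9 * g).
  have -> : (3 * g).+1 * (3 * g).+1 = 9 * (g * g) + 6 * g + 1 by lia.
  have -> : g.+1 * (9 * g) = 9 * (g * g) + 9 * g by lia.
  lia.
have {}h1 : a * g * (9 * g) <= (3 * g).+1 * k * (j * (3 * g)).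
  have -> : a * g * (9 * g) = a * (3 * g) * (3 * g) by lia.
  apply: leq_trans (leq_mul h1 (leqnn (3 * g))) _.
  by apply: eq_leq; lia.
apply: leq_trans h1 _.
apply: leq_trans (leq_mul (leqnn ((3 * g).+1 * k)) h2) _.
rewrite mulnACA.
have -> : g.+1 * (i * (k' * k)) * (9 * g)
  = g.+1 * (9 * g) * (k * (i * k')) by lia.
by rewrite leq_mul.
Qed.

Section Words.
Variables (T : finType) (G : {group {perm T}}).
Local Open Scope group_scope.
Local Open Scope nat_scope.

(** A scheme assigns to each cell either an index i with a permutation u, the
cell then receiving u applied to the i-th letter, or a constant letter. *)
Definition scheme (Om I : Type) := Om -> I * {perm T} + T.

(** The word over Om obtained from the word W over I. *)
Definition fill (Om I : finType) (S : scheme Om I) (W : {ffun I -> T}) :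
    {ffun Om -> T} :=
  [ffun w => match S w with inl iu => iu.2 (W iu.1) | inr c => c end].

(** The cells that depend on the i-th letter. *)
Definition free_cells (Om I : finType) (S : scheme Om I) (i : I) : {pred Om} :=
  fun w => if S w is inl iu then iu.1 == i else false.

(** The permutations belong to G, and each index occurs in exactly k cells. *)
Definition valid_scheme (Om I : finType) (k : nat) (S : scheme Om I) : Prop :=
  (forall w iu, S w = inl iu -> iu.2 \in G) /\
  (forall i, #|free_cells S i| = k).

(** The color of a word is unchanged when its letters are replaced by E-related
ones. *)
Definition respects (I C : finType) (E : T -> T -> Prop)
    (chi : {ffun I -> T} -> C) : Prop :=
  forall W W' : {ffun I -> T}, (forall i, E (W i) (W' i)) -> chi W = chi W'.

(** For all I, r and g there are sizes k > 0 and #|Om| <= (1 + 1 / g) * #|I| * k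
such that each r-coloring of the words over Om has a scheme after which it
respects E. Both sizes are chosen before the coloring. *)
Definition achievable (E : T -> T -> Prop) : Prop :=
  forall (I : finType) (r g : nat), exists (Om : finType) (k : nat),
    [/\ 0 < k, #|Om| * g <= g.+1 * (#|I| * k) &
    forall chi : {ffun Om -> T} -> 'I_r, exists S : scheme Om I,
      valid_scheme k S /\ respects E (chi \o fill S)].

Section Step.
Variables (E : T -> T -> Prop) (tau : {perm T}) (z : T).
Hypotheses (Erefl : forall x, E x x) (Esym : forall x y, E x y -> E y x)
  (Etrans : forall x y w, E x y -> E y w -> E x w).
Hypotheses (Etau : forall x y, E x y -> E (tau x) (tau y)) (tauG : tau \in G).

(** y is E-related to one of the first l letters of a cycle, which are
z, tau z, ..., tau^(l-1) z. *)
Definition in_prefix (l : nat) (y : T) : Prop :=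
  exists2 j, j < l & E y ((tau ^+ j) z).

(** E with the classes of the first l letters of a cycle merged into one. *)
Definition merge_rel (l : nat) (x y : T) : Prop :=
  E x y \/ in_prefix l x /\ in_prefix l y.

Lemma E_exp n x y : E x y -> E ((tau ^+ n) x) ((tau ^+ n) y).
Proof.
move=> Exy; elim: n => [|n IHn]; first by rewrite expg0 !perm1.
by rewrite expgSr !permM; apply: Etau.
Qed.

Lemma merge_sym l x y : merge_rel l x y -> merge_rel l y x.
Proof. by case=> [/Esym|[]]; [left|right]. Qed.

Variables (l q : nat).
Hypotheses (l0 : 0 < l) (lq : l < q) (tauq : tau ^+ q = 1%g).

(** The letter of a cell plugged with y, as a function of the marks of its
window: y moved by a power of tau, or the constant z. *)
Definition lead_letter D mk (y : T) : T :=
  oapp (fun e => (tau ^+ e) y) z (lead l q D mk).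

(** The letter given by the phase of the window alone, z being the letter of a
pause. *)
Definition phase_letter D mk : T :=
  oapp (fun c => (tau ^+ c) z) z (phase l q D mk).

(** Plugging tau^j z amounts, for the coarser relation, to plugging z in the
window moved by j. *)
Lemma lead_phase_merge D mk j y : 0 < D -> j <= l -> E y ((tau ^+ j) z) ->
  merge_rel l (lead_letter D mk y) (phase_letter D (fun x => mk (j + x))).
Proof.
move=> D0 jl Ey; rewrite /lead_letter /phase_letter.
have := lead_phase mk D0 jl lq.
have zD : in_prefix l z by exists 0; rewrite // expg0 perm1.
case: lead => [e|-> /=]; last by left.
have Ee : E ((tau ^+ e) y) ((tau ^+ (j + e)) z).
  by rewrite expgD permM; apply: E_exp.
case: phase => [c -> /=|eb /=]; first by left; rewrite addnC.
right; split=> //; move: eb => /orP[lt|/andP[le lt]].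
  by exists (j + e); rewrite // addnC.
exists (e + j - q); first by lia.
have : j + e = e + j - q + q by lia.
by move=> je; move: Ee; rewrite je expgD tauq mulg1.
Qed.

(** The step from l to l + 1, for colorings that respect the merging of the
first l letters. *)
Lemma merge_step (I : finType) (r g : nat) :
  exists (Om : finType) (k : nat),
    [/\ 0 < k, #|Om| * g <= g.+1 * (#|I| * k) &
    forall chi : {ffun Om -> T} -> 'I_r, respects (merge_rel l) chi ->
    exists S : scheme Om I,
      valid_scheme k S /\ respects (merge_rel l.+1) (chi \o fill S)].
Proof.
have [D [b [D0 good0 dens]]] := lead_density g lq.
set m := (D + 2) * q in good0 dens; set n := #|I|.
pose good := #|[pred v : {ffun 'I_m -> 'I_b.+1} |
  lead l q D (marks v) != None]|.
rewrite -/good in good0 dens.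
(* A list t of n * m positions provides one window of length m for each index,
   and its color is the whole coloring of the words over I filled along these
   windows. The blocks of length m + l leave room for moving each window. *)
have [M0 HM0] := ramsey {ffun {ffun I -> T} -> 'I_r} nat (n * m) (n * (m + l)).
pose M := M0 + m.
pose Om : finType := (I * {ffun 'I_M -> 'I_b.+1})%type.
exists Om, (good * #|'I_b.+1| ^ (M - m)); split.
- by rewrite muln_gt0 good0 expn_gt0 card_ord.
- move: dens; rewrite !card_prod !card_ffun !card_ord -/n => dens.
  rewrite -{1}(subnKC (leq_addl M0 m : m <= M)) expnD.
  have := leq_mul (leqnn (n * b.+1 ^ (M - m))) dens.
  lia.
move=> chi chiR.
pose mkr (t : seq nat) (i : I) (w : {ffun 'I_M -> 'I_b.+1}) (x : nat) : bool :=
  marks w (nth 0 t (enum_rank i * m + x)).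
pose sch (t : seq nat) : scheme Om I := fun iw =>
  if lead l q D (mkr t iw.1 iw.2) is Some e then inl (iw.1, tau ^+ e)
  else inr z.
have schE t W i w : fill (sch t) W (i, w) = lead_letter D (mkr t i w) (W i).
  by rewrite ffunE /sch /lead_letter /=; case: lead.
have M0M : M0 <= size (iota 0 M) by rewrite size_iota leq_addr.
have [s [sM szs [c Hc]]] :=
  HM0 (iota 0 M) (fun t => [ffun W => chi (fill (sch t) W)]) M0M.
pose blk (j : nat -> nat) :=
  mkseq (fun y => nth 0 s (y %/ m * (m + l) + j (y %/ m) + y %% m)) (n * m).
have m0 : 0 < m by rewrite muln_gt0 addn2 (leq_ltn_trans _ lq).
have blk_chi j W : (forall i, j i <= l) ->
    chi (fill (sch (blk j)) W) = chi (fill (sch (blk (fun=> 0))) W).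
  move=> jl.
  have H j' : (forall i, j' i <= l) -> chi (fill (sch (blk j')) W) = c W.
    move=> jl'; rewrite -(Hc (blk j')) ?ffunE ?size_mkseq//.
    exact: subseq_blocks.
  by rewrite !H.
pose mk0 (i : I) (w : {ffun 'I_M -> 'I_b.+1}) (x : nat) : bool :=
  marks w (nth 0 s (enum_rank i * (m + l) + x)).
have blkE j (i : I) x : x < m ->
    nth 0 (blk j) (enum_rank i * m + x)
      = nth 0 s (enum_rank i * (m + l) + (j (enum_rank i) + x)).
  move=> xm; have rn := ltn_ord (enum_rank i).
  rewrite nth_mkseq; last first.
    by have := leq_mul rn (leqnn m); rewrite mulSn -/n; lia.
  by rewrite divnMDl// modnMDl divn_small// modn_small// addn0 addnA.
have blk_lead j i w y : lead_letter D (mkr (blk j) i w) y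
    = lead_letter D (fun x => mk0 i w (j (enum_rank i) + x)) y.
  rewrite /lead_letter; congr (oapp _ _ _); apply: lead_local => // x xm.
  by rewrite /mkr /mk0 blkE.
have usort : uniq s by apply: (subseq_uniq sM); apply: iota_uniq.
exists (sch (blk (fun=> 0))); split.
  split=> [[i w] iu|i].
    by rewrite /sch /=; case: lead => // e [<-] /=; rewrite groupX.
  have pos_lt (x : 'I_m) : nth 0 s (enum_rank i * (m + l) + x) < M.
    have /(mem_subseq sM) : nth 0 s (enum_rank i * (m + l) + x) \in s.
      apply: mem_nth; rewrite szs; have := ltn_ord x.
      have := leq_mul (ltn_ord (enum_rank i)) (leqnn (m + l)).
      rewrite mulSn -/n; lia.
    by rewrite mem_iota.
  pose p (x : 'I_m) : 'I_M := Ordinal (pos_lt x).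
  have pinj : injective p.
    move=> x y [] /eqP; rewrite nth_uniq// ?szs ?eqn_add2l.
    - by move/eqP/val_inj.
    - have := leq_mul (ltn_ord (enum_rank i)) (leqnn (m + l)).
      by have := ltn_ord x; rewrite mulSn -/n; lia.
    - have := leq_mul (ltn_ord (enum_rank i)) (leqnn (m + l)).
      by have := ltn_ord y; rewrite mulSn -/n; lia.
  have := card_pullback [pred v : {ffun 'I_m -> 'I_b.+1} |
    lead l q D (marks v) != None] pinj.
  rewrite !card_ord => <-.
  have injp : injective (fun w : {ffun 'I_M -> 'I_b.+1} => (i, w)).
    by move=> w w' [].
  rewrite -(card_imset _ injp).
  have leadE w : lead l q D (mkr (blk (fun=> 0)) i w)
      = lead l q D (marks [ffun x => w (p x)]).
    apply: lead_local => // x xm.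
    rewrite /mkr blkE// -[x]/(nat_of_ord (Ordinal xm)) marksE ffunE.
    by rewrite -(marksE w).
  apply: eq_card => -[i' w]; rewrite /free_cells /sch unfold_in /=.
  apply/idP/imsetP => [|[v vA [-> ->]]]; last first.
    have : lead l q D (mkr (blk (fun=> 0)) i v) != None.
      by rewrite leadE; exact: vA.
    by case: lead => //= e _; rewrite eqxx.
  case le : (lead _ _ _ _) => [e|//] /= /eqP ii.
  exists w; last by rewrite ii.
  suff : lead l q D (marks [ffun x => w (p x)]) != None by [].
  by rewrite -leadE -ii le.
move=> W W' WW' /=.
(* Each letter related to one of z, ..., tau^l z may be replaced by z: for
   tau^j z at the index i, move the window of i by j. *)
have normal (V : {ffun I -> T}) : exists V0 : {ffun I -> T},
    (forall i, in_prefix l.+1 (V i) /\ V0 i = z \/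
               ~ in_prefix l.+1 (V i) /\ V0 i = V i) /\
    chi (fill (sch (blk (fun=> 0))) V) = chi (fill (sch (blk (fun=> 0))) V0).
  have /fin_all_exists[f fP] : forall i, exists jw : nat * T, jw.1 <= l /\
      (E (V i) ((tau ^+ jw.1) z) /\ jw.2 = z \/
       ~ in_prefix l.+1 (V i) /\ jw = (0, V i)).
    move=> i; have [[j jl Ej]|noprefix] := EM (in_prefix l.+1 (V i)).
      by exists (j, z); split=> //; left.
    by exists (0, V i); split=> //; right.
  pose j x := if insub x is Some y then (f (enum_val (y : 'I_n))).1 else 0.
  have jE i : j (enum_rank i) = (f i).1 by rewrite /j valK enum_rankK.
  have jl x : j x <= l.
    by rewrite /j; case: insubP => // y _ _; case: (fP (enum_val y)).
  exists [ffun i => (f i).2]; split=> [i|].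
    rewrite ffunE; have [fl [[Ei ->]|[nt ->]]] := fP i; last by right.
    by left; split=> //; exists (f i).1.
  rewrite -(blk_chi j [ffun i => (f i).2] jl).
  pose Q : {ffun Om -> T} := [ffun iw : Om =>
    if asbool (in_prefix l.+1 (V iw.1))
    then phase_letter D (fun x => mk0 iw.1 iw.2 ((f iw.1).1 + x))
    else fill (sch (blk (fun=> 0))) V iw].
  transitivity (chi Q); apply: chiR => -[i w]; rewrite [Q _]ffunE /=.
    have [fl [[Ei fz]|[nt fz]]] := fP i.
      case: asboolP => ti; last by left.
      by rewrite schE blk_lead; apply: lead_phase_merge.
    by case: asboolP => // _; left.
  rewrite [X in merge_rel _ _ X]schE ffunE blk_lead jE.
  have [fl [[Ei fz]|[nt fz]]] := fP i.
    case: asboolP => [_|[]]; last by exists (f i).1.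
    rewrite fz; apply: merge_sym.
    apply: (@lead_phase_merge D (fun x => mk0 i w ((f i).1 + x)) 0) => //.
    by rewrite expg0 perm1.
  case: asboolP => // _; left; rewrite schE blk_lead fz /=.
  exact: Erefl.
have [V [VW ->]] := normal W; have [V' [VW' ->]] := normal W'.
apply: chiR => -[i w]; left; rewrite !schE.
have EV : E (V i) (V' i).
  have prefixE x y : E x y -> in_prefix l.+1 x -> in_prefix l.+1 y.
    by move=> Exy [j jl Ej]; exists j => //; apply: Etrans (Esym Exy) Ej.
  have [[t ->]|[t ->]] := VW i; have [[t' ->]|[t' ->]] := VW' i => //.
  - by have [/prefixE/(_ t)|[]] := WW' i.
  - by have [/Esym/prefixE/(_ t')|[]] := WW' i.
  - by have [|[]] := WW' i.
by rewrite /lead_letter; case: lead => //= e; apply: E_exp.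
Qed.

End Step.

(** Fill the cells of S with the word that S' makes over J. *)
Definition scheme_comp (Om J I : finType) (S : scheme Om J)
    (S' : scheme J I) : scheme Om I := fun w =>
  match S w with
  | inl ju => match S' ju.1 with
              | inl iu => inl (iu.1, (iu.2 * ju.2)%g)
              | inr c => inr (ju.2 c)
              end
  | inr c => inr c
  end.

Lemma fill_comp (Om J I : finType) (S : scheme Om J) (S' : scheme J I) W :
  fill (scheme_comp S S') W = fill S (fill S' W).
Proof.
apply/ffunP => w; rewrite !ffunE /scheme_comp.
case: (S w) => [[j u]|c] //=; rewrite ffunE.
by case: (S' j) => [[i u']|c] //=; rewrite permM.
Qed.

Lemma valid_scheme_comp (Om J I : finType) (S : scheme Om J)
    (S' : scheme J I) k k' :
  valid_scheme k S -> valid_scheme k' S' ->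
  valid_scheme (k' * k) (scheme_comp S S').
Proof.
move=> [SG Sk] [SG' Sk']; split=> [w iu|i].
  rewrite /scheme_comp; case eS : (S w) => [ju|//].
  case eS' : (S' ju.1) => [iu'|//].
  by move=> [<-] /=; rewrite groupM ?(SG' _ _ eS') ?(SG _ _ eS).
rewrite -(Sk' i) -sum1_card.
have -> : \sum_(w in free_cells (scheme_comp S S') i) 1 =
    \sum_(j in free_cells S' i) \sum_(w in free_cells S j) 1.
  rewrite [RHS](exchange_big_dep predT)//= big_mkcond; apply: eq_bigr => w _.
  rewrite !unfold_in /scheme_comp.
  case eS : (S w) => [[j u]|c]; last first.
    by rewrite big_pred0// => j; rewrite !unfold_in eS andbF.
  rewrite (eq_bigl (fun j' => (j' == j) && (j \in free_cells S' i)));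
      last first.
    move=> j'; rewrite [w \in _]unfold_in eS /= [j == _]eq_sym andbC.
    by case: eqP => // ->.
  rewrite (unfold_in j) /=; case eS' : (S' j) => [[i' u']|c] /=; last first.
    by rewrite big_pred0// => j'; rewrite andbF.
  case: (i' == i); last by rewrite big_pred0// => j'; rewrite andbF.
  by rewrite (eq_bigl (pred1 j)) ?big_pred1_eq// => j'; rewrite andbT.
rewrite (eq_bigr (fun=> k)) ?sum_nat_const// => j _.
by rewrite sum1_card Sk.
Qed.

Lemma achievable_sub (E E' : T -> T -> Prop) :
  (forall x y, E' x y -> E x y) -> achievable E -> achievable E'.
Proof.
move=> sub aE I r g; have [Om [k [k0 bd H]]] := aE I r g.
exists Om, k; split=> // chi; have [S [Sv SE]] := H chi.
by exists S; split=> // W W' WW'; apply: SE => i; apply: sub.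
Qed.

Lemma achievable_eq : achievable (@eq T).
Proof.
move=> I r g; exists I, 1; split=> // [|chi].
  by rewrite muln1 mulSn mulnC leq_addl.
exists (fun i => inl (i, 1%g)); split; last first.
  by move=> W W' WW'; congr (chi (fill _ _)); apply/ffunP.
split=> [w iu [<-]|i]; first exact: group1.
by rewrite -[RHS](card1 i); apply: eq_card => j; rewrite !unfold_in.
Qed.

Section Join.
Variables (E : T -> T -> Prop) (tau : {perm T}).
Hypotheses (Erefl : forall x, E x x) (Esym : forall x y, E x y -> E y x)
  (Etrans : forall x y w, E x y -> E y w -> E x w).
Hypotheses (Etau : forall x y, E x y -> E (tau x) (tau y)) (tauG : tau \in G).

Lemma achievable_merge_step z l : 0 < l < #[tau] ->
  achievable (merge_rel E tau z l) -> achievable (merge_rel E tau z l.+1).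
Proof.
move=> /andP[l0 lq] aE I r g.
have [J [k' [k0' bd' H']]] := merge_step z Erefl Esym Etrans Etau tauG l0 lq
  (expg_order tau) I r (3 * g).
have [Om [k [k0 bd H]]] := aE J r (3 * g).
exists Om, (k' * k); split=> [||chi]; first by rewrite muln_gt0 k0'.
  exact: ratio_comp bd bd'.
have [S [Sv SE]] := H chi.
have [S' [Sv' SE']] := H' _ SE.
exists (scheme_comp S S'); split; first exact: valid_scheme_comp.
by move=> W W' WW' /=; rewrite !fill_comp; apply: SE'.
Qed.

Lemma achievable_merge z :
  achievable E -> achievable (merge_rel E tau z #[tau]).
Proof.
move=> aE; have q0 := order_gt0 tau.
suff H l : l < #[tau] -> achievable (merge_rel E tau z l.+1).
  by rewrite -(prednK q0); apply: H; rewrite prednK.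
elim: l => [_|l IHl lq]; last first.
  by apply: achievable_merge_step => //; apply/IHl/ltnW.
apply: achievable_sub aE => x y [//|[[[|//] _ Ex] [[|//] _ Ey]]].
by apply: Etrans (Esym Ey).
Qed.

End Join.

(** The join of E with the orbits of tau. *)
Lemma achievable_join (E : T -> T -> Prop) (tau : {perm T}) :
  (forall x, E x x) -> (forall x y, E x y -> E y x) ->
  (forall x y w, E x y -> E y w -> E x w) ->
  (forall x y, E x y -> E (tau x) (tau y)) -> tau \in G ->
  achievable E ->
  achievable (fun x y => exists i, E ((tau ^+ i) x) y).
Proof.
move=> Erefl Esym Etrans Etau tauG aE.
suff H (s : seq T) : exists F : T -> T -> Prop,
    [/\ [/\ forall x, F x x, forall x y, F x y -> F y x
          & forall x y w, F x y -> F y w -> F x w],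
        forall x y, F x y -> F (tau x) (tau y), achievable F,
        forall x y, E x y -> F x y & {in s, forall z, F z (tau z)}].
  have [F [[Frefl Fsym Ftrans] Ftau aF EF Fs]] := H (enum T).
  apply: achievable_sub aF => x y [i /EF].
  apply: (Ftrans); elim: i => [|i IHi]; first by rewrite expg0 perm1.
  rewrite expgSr permM; apply: (Ftrans) IHi _; apply: Fs; exact: mem_enum.
elim: s => [|z s [F [[Frefl Fsym Ftrans] Ftau aF EF Fs]]].
  by exists E; split.
have q0 := order_gt0 tau.
have prefixT x y :
    F x y -> in_prefix F tau z #[tau] x -> in_prefix F tau z #[tau] y.
  by move=> Fxy [j jl Fj]; exists j => //; apply: Ftrans (Fsym _ _ Fxy) Fj.
have prefix_any x j : F x ((tau ^+ j) z) -> in_prefix F tau z #[tau] x.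
  by exists (j %% #[tau]); rewrite ?ltn_pmod ?expg_mod_order.
have prefix_tau x :
    in_prefix F tau z #[tau] x -> in_prefix F tau z #[tau] (tau x).
  move=> [j _ Fj]; apply: (@prefix_any _ j.+1).
  by rewrite expgSr permM; apply: Ftau.
exists (merge_rel F tau z #[tau]); split; first split.
- by left.
- by move=> x y [/Fsym|[]]; [left|right].
- move=> x y w [Fxy|[tx ty]] [Fyw|[ty' tw]].
  + by left; apply: Ftrans Fyw.
  + by right; split=> //; apply: prefixT (Fsym _ _ Fxy) ty'.
  + by right; split=> //; apply: prefixT Fyw ty.
  + by right.
- by move=> x y [/Ftau|[/prefix_tau tx /prefix_tau ty]]; [left|right].
- exact: achievable_merge.
- by move=> x y /EF; left.
- move=> x; rewrite inE => /predU1P[->|xs]; last by left; apply: Fs.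
  right; split; first by apply: (@prefix_any _ 0); rewrite expg0 perm1.
  by apply: (@prefix_any _ 1); rewrite expg1.
Qed.

(** x and y are in the same H-orbit. *)
Definition orbit_rel (H : {set {perm T}}) (x y : T) : Prop :=
  exists2 s, s \in H & s x = y.

Lemma achievable_der1 (H : {group {perm T}}) : H \subset G ->
  achievable (orbit_rel H^`(1)) -> achievable (orbit_rel H).
Proof.
move=> sHG aE.
have sH'H : H^`(1) \subset H by exact: der_sub.
(* The elements of H are treated one at a time, keeping an equivalence that is
   H-invariant and coarser than the orbit relation of H^`(1). *)
suff K (ts : seq {perm T}) : {subset ts <= H} -> exists F : T -> T -> Prop,
    [/\ [/\ forall x, F x x, forall x y, F x y -> F y x
          & forall x y w, F x y -> F y w -> F x w],
        forall (h : {perm T}) x y, h \in H -> F x y -> F (h x) (h y),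
        achievable F,
        forall (h : {perm T}) x, h \in H^`(1) -> F x (h x)
        & forall (h : {perm T}) x, h \in ts -> F x (h x)].
  have [|F [_ _ aF _ FH]] := K (enum H).
    by move=> h; rewrite mem_enum.
  apply: achievable_sub aF => x _ [h hH <-]; apply: FH.
  by rewrite mem_enum.
elim: ts => [_|tau ts IHts tsH].
  exists (orbit_rel H^`(1)); split; first split.
  - by move=> x; exists 1%g; rewrite ?group1 ?perm1.
  - by move=> x _ [h hH <-]; exists (h^-1)%g; rewrite ?groupV ?permK.
  - move=> x _ _ [h hH <-] [h' hH' <-].
    by exists (h * h')%g; rewrite ?groupM ?permM.
  - move=> h x _ hH [k kH <-].
    exists (k ^ h)%g; last by rewrite conjgE !permM permK.
    by rewrite memJ_norm// (fintype.subsetP (der_norm _ _)).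
  - by [].
  - by move=> h x hH; exists h.
  - by [].
have [|F [[Frefl Fsym Ftrans] FH aF Fder Fts]] := IHts.
  by move=> h hts; apply: tsH; rewrite inE hts orbT.
have tauH : tau \in H by apply: tsH; rewrite inE eqxx.
have Fexp i x y : F x y -> F ((tau ^+ i) x) ((tau ^+ i) y).
  by apply: FH; rewrite groupX.
exists (fun x y => exists i, F ((tau ^+ i) x) y); split; first split.
- by move=> x; exists 0; rewrite expg0 perm1.
(* The inverse of tau^i is tau^(i * (#[tau] - 1)). *)
- move=> x y [i Fi]; exists (i * #[tau].-1); move/(Fexp (i * #[tau].-1)): Fi.
  rewrite -permM -expgD -mulnS prednK ?order_gt0//.
  by rewrite mulnC expgM expg_order expg1n perm1 => /Fsym.
- move=> x y w [i Fi] [j Fj]; exists (i + j); rewrite expgD permM.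
  by apply: Ftrans Fj; apply: Fexp.
(* tau^i and h commute up to an element of H^`(1), which F ignores. *)
- move=> h x y hH [i Fi]; exists i; apply: Ftrans (FH h _ _ hH Fi).
  have -> : h ((tau ^+ i) x) = [~ tau ^+ i, h]%g ((tau ^+ i) (h x)).
    by rewrite -[LHS]permM commgC !permM.
  apply: Fder; apply: mem_commg => //; exact: groupX.
- apply: achievable_join => //; last by rewrite (fintype.subsetP sHG).
  by move=> x y; apply: FH.
- by move=> h x hH; exists 0; rewrite expg0 perm1; apply: Fder.
- move=> h x; rewrite inE => /predU1P[->|hts].
    by exists 1; rewrite expg1.
  by exists 0; rewrite expg0 perm1; apply: Fts.
Qed.

Lemma achievable_solvable : solvable G -> achievable (orbit_rel G).
Proof.
move=> /derivedP[n Gn].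
suff H i : achievable (orbit_rel G^`(n - i)).
  by have := H n; rewrite subnn derg0.
elim: i => [|i IHi].
  rewrite subn0 Gn; apply: achievable_sub achievable_eq => x y [s /set1P->].
  by rewrite perm1.
have [ni|ni] := leqP n i.
  have -> : n - i.+1 = n - i by lia.
  exact: IHi.
apply: achievable_der1; first exact: der_sub.
have -> : (G^`(n - i.+1)^`(1) = G^`(n - i))%g by rewrite -(subnSK ni) dergSn.
exact: IHi.
Qed.

End Words.

(** * Vectors attached to words *)

Local Open Scope classical_set_scope.
Local Open Scope ring_scope.

Section Norm.
Variable R : realType.

Lemma enorm_sqr d (u : 'rV[R]_d) : enorm u ^+ 2 = \sum_i u 0 i ^+ 2.
Proof. by rewrite sqr_sqrtr// sumr_ge0// => i _; rewrite sqr_ge0. Qed.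

Lemma enorm_ge0 d (u : 'rV[R]_d) : 0 <= enorm u.
Proof. exact: sqrtr_ge0. Qed.

Lemma enorm_eq d m (u : 'rV[R]_d) (v : 'rV[R]_m) :
  enorm u ^+ 2 = enorm v ^+ 2 -> enorm u = enorm v.
Proof. by move/eqP; rewrite eqrXn2 ?enorm_ge0// => /eqP. Qed.

Variables (Om : finType) (d : nat).

(** The vector with first coordinate a and blocks lam * v w, for w in Om. *)
Definition embed (a lam : R) (v : Om -> 'rV[R]_d) : 'rV[R]_(1 + #|Om| * d) :=
  row_mx (const_mx a : 'rV[R]_1)
    (mxvec (\matrix_(i, j) (lam * v (enum_val i) 0 j))).

Lemma embedB a a' lam v v' :
  embed a lam v - embed a' lam v' = embed (a - a') lam (fun w => v w - v' w).
Proof.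
rewrite /embed opp_row_mx add_row_mx -linearB; congr (row_mx _ (mxvec _)).
  by apply/matrixP => i j; rewrite !mxE.
by apply/matrixP => i j; rewrite !mxE mulrBr.
Qed.

Lemma enorm_embed a lam v :
  enorm (embed a lam v) ^+ 2 = a ^+ 2 + lam ^+ 2 * \sum_w enorm (v w) ^+ 2.
Proof.
rewrite enorm_sqr big_split_ord /= big_ord1.
rewrite /embed row_mxEl mxE; congr (_ + _).
under eq_bigr do rewrite row_mxEr.
rewrite (reindex _ (curry_mxvec_bij _ _)) /=.
rewrite mulr_sumr [RHS](reindex _ (onW_bij _ (@enum_val_bij Om))) /=.
rewrite [RHS](eq_bigr (fun i => \sum_j (lam * v (enum_val i) 0 j) ^+ 2)).
  rewrite pair_bigA /=; apply: eq_bigr => -[i j] _ /=.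
  by rewrite mxvecE mxE.
move=> i _; rewrite enorm_sqr mulr_sumr.
by apply: eq_bigr => j _; rewrite exprMn.
Qed.

End Norm.

(** * Permutations of points induced by isometries *)

Section PointGroup.
Variables (R : realType) (d : nat) (s : seq 'rV[R]_d).

(** The isometry g permutes the points of s as p does. *)
Definition induces (g : Isom R d) (p : {perm seq_sub s}) : Prop :=
  forall t, val (p t) = g (val t).

Lemma induces1 : induces 1%g 1%g.
Proof. by move=> t; rewrite perm1. Qed.

(** Isometries are composed from right to left and permutations from left to
right, hence the reversal. *)
Lemma inducesM g h p q :
  induces g p -> induces h q -> induces (h * g)%g (p * q)%g.
Proof. by move=> gp hq t; rewrite permM hq gp. Qed.

Lemma inducesV g p : induces g p -> induces g^-1%g p^-1%g.
Proof.
move=> gp t; rewrite -[in RHS](permKV p t) gp.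
by rewrite -[RHS]/((g^-1 * g)%g _) mulVg.
Qed.

Lemma is_subgroup_derived (A : set (Isom R d)) :
  is_subgroup (derived_subgroup A).
Proof.
split=> [|x y].
  by rewrite inE => H [[H1 _] _]; move: H1; rewrite inE.
rewrite !inE => xA yA H HH; have [[_ HV] _] := HH.
by have := HV x y; rewrite !inE; apply; [exact: xA|exact: yA].
Qed.

(** The permutations of s induced by the isometries in A. *)
Definition point_group (A : set (Isom R d)) : {set {perm seq_sub s}} :=
  [set p : {perm seq_sub s} | `[< exists2 g, A g & induces g p >] ]%SET.

Lemma mem_point_group A p :
  p \in point_group A <-> exists2 g, A g & induces g p.
Proof. by rewrite !inE. Qed.

Lemma point_group_set A : is_subgroup A -> group_set (point_group A).
Proof.
move=> Agrp; apply/group_setP; split=> [|x y].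
  apply/mem_point_group; exists 1%g; last exact: induces1.
  by have [+ _] := Agrp; rewrite inE.
move=> /mem_point_group[g gA gx] /mem_point_group[h hA hy].
apply/mem_point_group; exists (h * g)%g; last exact: inducesM.
by have := group_closedM Agrp; move=> /(_ h g); rewrite !inE; apply.
Qed.

(** The derived series of G is induced by that of A. *)
Lemma solvable_point_group (A : set (Isom R d)) (G : {group {perm seq_sub s}}) :
  is_subgroup A -> is_solvable A ->
  (forall p, p \in G -> exists2 g, A g & induces g p) -> solvable G.
Proof.
move=> Agrp [n An] GA; apply/derivedP; exists n.
have der m : is_subgroup (derived_series A m) /\ (forall p, p \in (G^`(m))%g ->
    exists2 g, derived_series A m g & induces g p).
  elim: m => [|m [IHgrp IHm]]; first by split=> // p; rewrite derg0 => /GA.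
  have grpS := is_subgroup_derived (derived_series A m).
  split=> // p.
  suff /fintype.subsetP KP : (G^`(m.+1) \subset Group (point_group_set grpS))%g.
    by move=> /KP /mem_point_group.
  rewrite dergSn gen_subG; apply/fintype.subsetP => _ /imset2P[x y xG yG ->].
  have [g gA gx] := IHm x xG; have [h hA hy] := IHm y yG.
  have VA := group_closedV IHgrp.
  apply/mem_point_group; exists [~ h^-1, g^-1]%g.
    move=> H [_ HH]; apply: HH; exists h^-1%g.
      by have := VA h; rewrite !inE; apply.
    exists g^-1%g => //.
    by have := VA g; rewrite !inE; apply.
  have -> : [~ h^-1, g^-1]%g = (h * g * h^-1 * g^-1)%g.
    by rewrite commgEl conjgE !invgK !mulgA.
  rewrite commgEl conjgE.
  apply: (inducesM (inducesV gx)); apply: (inducesM (inducesV hy)).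
  exact: inducesM.
apply/trivgP/fintype.subsetP => p pG.
have [_ /(_ p pG)[g]] := der n; rewrite An => -> pE.
by rewrite inE; apply/eqP/permP => t; apply: val_inj; rewrite pE perm1.
Qed.

Lemma induces_exists (g : Isom R d) :
  (forall t, t \in s -> g t \in s) -> exists p, induces g p.
Proof.
move=> gs; have /asboolP[_ /bij_inj ginj] := Defs.isomP g.
pose f (t : seq_sub s) : seq_sub s := SeqSub (gs _ (valP t)).
have finj : injective f by move=> x y [] /ginj /val_inj.
by exists (perm finj) => t; rewrite permE.
Qed.

End PointGroup.

(** * Coloring the sphere through words *)

Theorem theorem2 (R : realType) (d : nat) (P : set 'rV[R]_d) (rho : R) :
  finite_set P -> spherical P -> is_circumradius P rho ->
  (exists G : set (Isom R d),
     [/\ is_subgroup G, is_solvable G, preserves G P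
       & acts_transitively G P]) ->
  nearcircumsphere_ramsey P rho.
Proof.
move=> /finite_seqP[s ->] _ [rho0 [o [oP Pnorm]]] [A [Agrp Asolv Apres Atrans]].
move=> r eps eps0.
have [x0 _] : exists x0 : seq_sub s, True.
  have [[|k] [p [w [pP w1 _]]]] := oP.
    by move: w1; rewrite big_ord0 => /esym/eqP; rewrite oner_eq0.
  by exists (SeqSub (pP ord0)).
pose G := Group (point_group_set s Agrp).
have Gsolv : solvable G.
  by apply: (solvable_point_group Agrp Asolv) => p /mem_point_group.
have Gtrans (x y : seq_sub s) : orbit_rel G x y.
  have [g gA gxy] := Atrans (val x) (val y) (valP x) (valP y).
  have [p gp] : exists p, induces (s := s) g p.
    apply: induces_exists => t ts.
    suff : [set` s] (g t) by [].
    by rewrite -(Apres g gA); exists t.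
  exists p; first by apply/mem_point_group; exists g.
  by apply: val_inj; rewrite gp.
have Giso p x y : p \in G ->
    enorm (val (p x) - val (p y)) = enorm (val x - val y :> 'rV[R]_d).
  move=> /mem_point_group[g _ gp]; rewrite !gp.
  by have /asboolP[+ _] := Defs.isomP g; apply.
have rad0 : 0 < rho + eps by lra.
(* g controls the excess #|Om| / k <= 1 + 1 / g. *)
pose delta := (rho + eps) ^+ 2 - rho ^+ 2.
have delta0 : 0 < delta by rewrite /delta; nra.
pose g := (Num.bound (rho ^+ 2 / delta)).+1.
have gP : rho ^+ 2 <= g%:R * delta.
  rewrite -ler_pdivrMr// ltW// (lt_le_trans (archi_boundP _))//.
    by rewrite divr_ge0 ?sqr_ge0 ?ltW.
  by rewrite ler_nat.
have [Om [k [k0 Omk H]]] := achievable_solvable Gsolv unit r g.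
rewrite card_unit mul1n in Omk.
have k0R : 0 < k%:R :> R by rewrite ltr0n.
have normOm : #|Om|%:R * rho ^+ 2 / k%:R <= (rho + eps) ^+ 2.
  have g0 : 0 < g%:R :> R by rewrite ltr0n.
  rewrite ler_pdivrMr// -(ler_pM2l g0).
  have : #|Om|%:R * g%:R <= (g%:R + 1) * k%:R :> R.
    by rewrite natr1 -!natrM ler_nat.
  move=> /(ler_wpM2r (sqr_ge0 rho)).
  move: gP => /(ler_wpM2l (ltW k0R)); rewrite /delta.
  move: (g%:R : R) (k%:R : R) (#|Om|%:R : R) (rho ^+ 2) ((rho + eps) ^+ 2).
  by move=> u v w x y h1 h2; lra.
pose lam : R := (Num.sqrt k%:R)^-1.
have lamE : lam ^+ 2 = k%:R^-1 by rewrite exprVn sqr_sqrtr// ltW.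
(* The extra coordinate a brings the norm of all vectors to rho + eps. *)
pose a := Num.sqrt ((rho + eps) ^+ 2 - #|Om|%:R * rho ^+ 2 / k%:R).
have aE : a ^+ 2 = (rho + eps) ^+ 2 - #|Om|%:R * rho ^+ 2 / k%:R.
  by rewrite sqr_sqrtr// subr_ge0.
pose vec (W : {ffun Om -> seq_sub s}) := embed a lam (fun w => val (W w) - o).
have vecP W : sphere (#|Om| * d)%N (rho + eps) (vec W).
  rewrite /sphere /=; apply/eqP.
  rewrite -(eqrXn2 (n := 2)) ?enorm_ge0 ?ltW//.
  rewrite enorm_embed aE lamE (eq_bigr (fun=> rho ^+ 2)); last first.
    by move=> w _; rewrite Pnorm//; exact: valP.
  rewrite sumr_const -[_ *+ _]mulr_natl; apply/eqP; field.
  by rewrite gt_eqF.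
exists (#|Om| * d)%N => chi.
have [S [[SG Sk] SE]] := H (fun W => chi (exist _ (vec W) (mem_set (vecP W)))).
pose f (p : 'rV[R]_d) := vec (fill S [ffun=> insubd x0 p]).
exists (f @` [set` s]); split.
- exists f => // x y xs ys.
  apply: enorm_eq; rewrite /f /vec embedB enorm_embed subrr expr0n add0r lamE.
  rewrite (bigID (mem (free_cells S tt))) /= addrC big1 ?add0r; last first.
    move=> w; rewrite unfold_in !ffunE; case: (S w) => [[[] u] //|c _].
    by rewrite subrr enorm_sqr big1// => i _; rewrite mxE expr0n.
  rewrite (eq_bigr (fun=> enorm (x - y) ^+ 2)); last first.
    move=> w; rewrite unfold_in !ffunE; case E : (S w) => [[[] u]|//] _ /=.
    rewrite !ffunE opprB addrA subrK Giso ?(SG _ _ E)//.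
    by rewrite !insubdK.
  by rewrite sumr_const Sk -[X in _ * X]mulr_natl mulKf// gt_eqF.
- by move=> _ [p _ <-]; apply: vecP.
- exists (chi (exist _ (vec (fill S [ffun=> x0])) (mem_set (vecP _)))).
  move=> x [p _ px].
  have /= <- := SE [ffun=> insubd x0 p] [ffun=> x0] (fun=> Gtrans _ _).
  by congr chi; apply: val_inj.
Qed.
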